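(* Let $k$ be a commutative ring, $c'\in k$, and let $D_m$ ($m\ge 0$) be the $k$-linear endomorphisms of $M_k(c',0)$ defined recursively on the basis elements $u'(n_1,\dots,n_r)$ by $D_0(v_0)=v_0$, $D_m(v_0)=0$ for $m\ge 1$, and $$D_m u'(n_1,\dots,n_r)=\sum_{i=0}^m(-1)^i\binom{-n_1+1}{i}L(-n_1-i)\,D_{m-i}u'(n_2,\dots,n_r)\qquad(m\ge 0,\ r\ge 1).$$ Then for all $m\ge 0$, as operators on $M_k(c',0)$, $$L(-1)^m=D_1^m=m!\,D_m.$$
   Context: $\mathrm{Vir}_k$ is the Lie $k$-algebra that is free as a $k$-module on $L(n)$ ($n\in\mathbf{Z}$) and $K$, with brackets $[L(m),L(n)]=(m-n)L(m+n)+\delta_{m+n,0}\binom{m+1}{3}K$ and $[L(m),K]=0$. $\mathrm{Vir}_k^{\ge}$ is the Lie subalgebra spanned by $K$ and $L(m)$, $m\ge 0$. For $c'\in k$, let $U_{c'}=kv_0$ be the free rank one $\mathrm{Vir}_k^{\ge}$-module with $L(m)v_0=0$ ($m\ge 0$) and $Kv_0=c'v_0$, let $\mathrm{Ver}_{c'}$ be the $\mathrm{Vir}_k$-module induced from $U_{c'}$ (Verma module), let $I_{c'}$ be the $\mathrm{Vir}_k$-submodule generated by $L(-1)v_0$, and $M_k(c',0):=\mathrm{Ver}_{c'}/I_{c'}$. It is a free $k$-module with basis $u'(n_1,\dots,n_r):=L(-n_1)\cdots L(-n_r)v_0+I_{c'}$, $n_1\ge\cdots\ge n_r\ge 2$,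 $r\ge 0$ (the case $r=0$ being the image of $v_0$, again written $v_0$). $L(n)$ also denotes the induced operator on $M_k(c',0)$. Here $\binom{m}{n}=m(m-1)\cdots(m-n+1)/n!$ for $m\in\mathbf{Z}$, $n\ge 1$, and $\binom{m}{0}=1$. *)

(* Defs.v *)
From HB Require Import structures.
From mathcomp Require Import all_boot all_order all_algebra.
From mathcomp Require Import generic_quotient ring_quotient.
From mathcomp Require Import finmap.
From mathcomp.multinomials Require Import monalg.
From mathcomp Require Import boolp.
From mathcomp Require Import ring zify.

Set Implicit Arguments.
Unset Strict Implicit.
Unset Printing Implicit Defensive.

Import GRing.Theory.
Local Open Scope ring_scope.

(* The base ring is a [comPzRingType], so that the zero ring is allowed.      *)

(* [{malg k[X]}] is the group of finitely supported functions X -> k; its     *)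
(* library module structure requires k to be nonzero, hence the alias.        *)
Definition freemod (k : comPzRingType) (X : choiceType) : Type := {malg k[X]}.

Section FreeModule.
Variables (k : comPzRingType) (X : choiceType).
Implicit Types (a b : k) (x : X) (g h : {malg k[X]}).

HB.instance Definition _ := GRing.Zmodule.copy (freemod k X) {malg k[X]}.

Definition fm_scale a g : {malg k[X]} := [malg x in msupp g => a * g@_x].

Lemma fm_scaleE a g x : (fm_scale a g)@_x = a * g@_x.
Proof. by rewrite mcoeffE; case: msuppP; rewrite ?mulr0. Qed.

Fact fm_scaleA a b g : fm_scale a (fm_scale b g) = fm_scale (a * b) g.
Proof. by apply/malgP => x; rewrite !fm_scaleE mulrA. Qed.
Fact fm_scale1 : left_id 1 fm_scale.
Proof. by move=> g; apply/malgP => x; rewrite !fm_scaleE mul1r. Qed.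
Fact fm_scaleDr : right_distributive fm_scale +%R.
Proof.
by move=> a g h; apply/malgP => x; rewrite !(mcoeffD, fm_scaleE) mulrDr.
Qed.
Fact fm_scaleDl g : {morph fm_scale^~ g : a b / a + b}.
Proof.
by move=> a b; apply/malgP => x; rewrite !(mcoeffD, fm_scaleE) mulrDl.
Qed.

HB.instance Definition _ := GRing.Zmodule_isLmodule.Build k (freemod k X)
  fm_scaleA fm_scale1 fm_scaleDr fm_scaleDl.

End FreeModule.

HB.lock Definition fgen (k : comPzRingType) (X : choiceType) (x : X)
  : freemod k X := << 1 *g x >>.

Section FreeModuleTheory.
Variables (k : comPzRingType) (X : choiceType).
Implicit Types (a b : k) (x : X) (g h : {malg k[X]}).
Local Notation fgen := (fgen k).

Lemma fgenE x : fgen x = << 1 *g x >>. Proof. by rewrite unlock. Qed.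


Definition fcoef x (g : freemod k X) : k := @mcoeff X k x g.

Lemma fcoefP a x (g h : freemod k X) :
  fcoef x (a *: g + h) = a * fcoef x g + fcoef x h.
Proof. by rewrite /fcoef mcoeffD fm_scaleE. Qed.

Lemma fcoef0 x : fcoef x 0 = 0. Proof. exact: mcoeff0. Qed.

Lemma fcoef_gen x y : fcoef x (fgen y) = (y == x)%:R.
Proof. by rewrite fgenE; exact: mcoeffU. Qed.

Lemma freemod_ind (P : freemod k X -> Prop) :
  P 0 -> (forall a x g, P g -> P (a *: fgen x + g)) -> forall g, P g.
Proof.
move=> P0 PD g; rewrite (monalgE g).
elim: (msupp g : seq X) => [|x s IHs]; first by rewrite big_nil.
rewrite big_cons; suff -> : << g@_x *g x >> = g@_x *: fgen x by apply: PD.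
rewrite fgenE; apply/malgP => y; rewrite fm_scaleE !mcoeffU.
by case: eqP => _; rewrite ?mulr1n ?mulr0n ?mulr1 ?mulr0.
Qed.

Variables (V : lmodType k) (f : X -> V).

Definition fext (g : freemod k X) : V :=
  \sum_(x <- msupp (g : {malg k[X]})) fcoef x g *: f x.

Lemma fextw (d : {fset X}) (g : freemod k X) :
  (msupp (g : {malg k[X]}) `<=` d)%fset ->
  fext g = \sum_(x <- d) fcoef x g *: f x.
Proof.
move=> gd; rewrite /fext.
rewrite (big_fset_incl _ gd) // => x _ /mcoeff_outdom; rewrite /fcoef => ->.
by rewrite scale0r.
Qed.

Lemma fext_is_linear : linear fext.
Proof.
move=> a g h.
pose d := (msupp (g : {malg k[X]}) `|` msupp (h : {malg k[X]})
  `|` msupp ((a *: g + h : freemod k X) : {malg k[X]}))%fset.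
rewrite !(@fextw d) ?fsubsetUr //; last first.
- by rewrite /d -fsetUA fsubsetUl.
- by rewrite /d fsetUAC fsubsetUr.
rewrite scaler_sumr -big_split /=; apply: eq_bigr => x _.
by rewrite fcoefP scalerDl scalerA.
Qed.
HB.instance Definition _ :=
  GRing.isLinear.Build k (freemod k X) V *:%R fext fext_is_linear.

Lemma fext_gen x : fext (fgen x) = f x.
Proof.
rewrite (@fextw [fset x]%fset) ?fgenE ?msuppU_le // big_seq_fset1.
by rewrite -fgenE fcoef_gen eqxx scale1r.
Qed.

End FreeModuleTheory.

Section Span.
Variables (k : comPzRingType) (V : lmodType k).

Definition span (S : V -> Prop) : {pred V} := fun v => `[< forall N : {pred V},
  submod_closed N -> (forall u, S u -> u \in N) -> v \in N >].

Variable S : V -> Prop.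

Lemma mem_span v : S v -> v \in span S.
Proof. by move=> Sv; apply/asboolP => N _; apply. Qed.

Lemma span_ind (P : V -> Prop) : P 0 ->
  (forall (a : k) u v, P u -> P v -> P (a *: u + v)) ->
  (forall u, S u -> P u) -> forall v, v \in span S -> P v.
Proof.
move=> P0 PD SP v /asboolP /(_ (fun u => `[< P u >])) Nv.
apply/asboolP/Nv => [|u /SP Pu]; last exact/asboolP.
split=> [|a u w /asboolP Pu /asboolP Pw]; first exact/asboolP.
by apply/asboolP/PD.
Qed.

Fact span_submod_closed : submod_closed (span S).
Proof.
split=> [|a u v /asboolP Nu /asboolP Nv]; apply/asboolP => N N2 SN.
  by case: N2.
by apply: N2.2; [apply: Nu|apply: Nv].
Qed.
HB.instance Definition _ :=
  GRing.isSubmodClosed.Build k V (span S) span_submod_closed.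

End Span.

Section SubmodClosedOpp.
Variables (k : comPzRingType) (V : lmodType k) (N : submodClosed V).
Definition submod_zmod : {pred V} := N.
Fact submod_zmod_closed : zmod_closed submod_zmod.
Proof.
split=> [|u v Nu Nv]; first exact: rpred0.
by rewrite -scaleN1r; apply: rpredD => //; apply: rpredZ.
Qed.
HB.instance Definition _ := GRing.isZmodClosed.Build V submod_zmod
  submod_zmod_closed.
End SubmodClosedOpp.

Definition lquot (k : comPzRingType) (V : lmodType k) (N : submodClosed V)
  : Type := Quotient.quot (submod_zmod N).

Section QuotientModule.
Variables (k : comPzRingType) (V : lmodType k) (N : submodClosed V).

HB.instance Definition _ := GRing.Zmodule.copy (lquot N) (Quotient.quot (submod_zmod N)).

Definition lpi (v : V) : lquot N := \pi_(Quotient.quot (submod_zmod N))%qT v.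
Definition lrepr (q : lquot N) : V := repr (q : Quotient.quot (submod_zmod N)).

Lemma lreprK q : lpi (lrepr q) = q. Proof. exact: reprK. Qed.

Lemma lquot_ind (P : lquot N -> Prop) : (forall v, P (lpi v)) -> forall q, P q.
Proof. by move=> Pv q; rewrite -[q]lreprK. Qed.

Lemma lpiP u v : lpi u = lpi v <-> u - v \in N.
Proof.
by split=> [|uvN]; [move/eqP|apply/eqP]; rewrite piE /Quotient.equiv.
Qed.

Fact lpiD u v : lpi (u + v) = lpi u + lpi v.
Proof. by rewrite /lpi !piE. Qed.

Definition lquot_scale (a : k) (q : lquot N) : lquot N := lpi (a *: lrepr q).

Lemma lpiZ_def a v : lpi (a *: v) = lquot_scale a (lpi v).
Proof. by apply/lpiP; rewrite -scalerBr rpredZ //; apply/lpiP; rewrite lreprK. Qed.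

Fact lquot_scaleA a b q : lquot_scale a (lquot_scale b q) = lquot_scale (a * b) q.
Proof. by elim/lquot_ind: q => v; rewrite -!lpiZ_def scalerA. Qed.
Fact lquot_scale1 : left_id 1 lquot_scale.
Proof. by elim/lquot_ind => v; rewrite -lpiZ_def scale1r. Qed.
Fact lquot_scaleDr : right_distributive lquot_scale +%R.
Proof.
move=> a; elim/lquot_ind=> u; elim/lquot_ind=> v.
by rewrite -lpiD -!lpiZ_def scalerDr lpiD.
Qed.
Fact lquot_scaleDl q : {morph lquot_scale^~ q : a b / a + b}.
Proof.
by move=> a b; elim/lquot_ind: q => v; rewrite -!lpiZ_def scalerDl lpiD.
Qed.
HB.instance Definition _ := GRing.Zmodule_isLmodule.Build k (lquot N)
  lquot_scaleA lquot_scale1 lquot_scaleDr lquot_scaleDl.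

Fact lpi_is_linear : linear lpi.
Proof. by move=> a u v; rewrite lpiD lpiZ_def. Qed.
HB.instance Definition _ :=
  GRing.isLinear.Build k V (lquot N) *:%R lpi lpi_is_linear.

End QuotientModule.

Arguments lpi {k V} N v.

HB.mixin Record Lmodule_isLie (k : comPzRingType) g of GRing.Lmodule k g := {
  lie : g -> g -> g;
  lie_linearl : forall (a : k) x y z,
    lie (a *: x + y) z = a *: lie x z + lie y z;
  lie_linearr : forall (a : k) x y z,
    lie x (a *: y + z) = a *: lie x y + lie x z;
  liexx : forall x, lie x x = 0;
  lie_jacobi : forall x y z,
    lie x (lie y z) + lie y (lie z x) + lie z (lie x y) = 0
}.

#[short(type="lieType")]
HB.structure Definition LieAlgebra (k : comPzRingType) :=
  {g of GRing.Lmodule k g & Lmodule_isLie k g}.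

HB.mixin Record Lmodule_isLieModule (k : comPzRingType) (g : lieType k) V
    of GRing.Lmodule k V := {
  act : g -> V -> V;
  act_linearl : forall (a : k) x y v,
    act (a *: x + y) v = a *: act x v + act y v;
  act_linearr : forall (a : k) x u v,
    act x (a *: u + v) = a *: act x u + act x v;
  act_lie : forall x y v, act (lie x y) v = act x (act y v) - act y (act x v)
}.

#[short(type="lieModType")]
HB.structure Definition LieModule (k : comPzRingType) (g : lieType k) :=
  {V of GRing.Lmodule k V & Lmodule_isLieModule k g V}.

HB.mixin Record isActClosed (k : comPzRingType) (g : lieType k)
    (V : lieModType g) (S : V -> bool) := {
  act_closed : forall (x : g) v, v \in S -> act x v \in S
}.

#[short(type="lieSubmodType")]
HB.structure Definition LieSubmodule (k : comPzRingType) (g : lieType k)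
    (V : lieModType g) := {S of @GRing.SubmodClosed k V S & isActClosed k g V S}.

Section LieQuotient.
Variables (k : comPzRingType) (g : lieType k) (V : lieModType g).
Variable N : lieSubmodType V.

Definition lquot_act (x : g) (q : lquot N) : lquot N := lpi N (act x (lrepr q)).

Lemma lquot_act_pi x v : lquot_act x (lpi N v) = lpi N (act x v).
Proof.
apply/lpiP.
have -> : act x (lrepr (lpi N v)) - act x v = act x (lrepr (lpi N v) - v).
  by rewrite [in RHS]addrC -scaleN1r act_linearr scaleN1r addrC.
by apply: act_closed; apply/lpiP; rewrite lreprK.
Qed.

Fact lquot_act_linearl (a : k) x y q :
  lquot_act (a *: x + y) q = a *: lquot_act x q + lquot_act y q.
Proof.
by elim/lquot_ind: q => v; rewrite !lquot_act_pi act_linearl linearP.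
Qed.
Fact lquot_act_linearr (a : k) x p q :
  lquot_act x (a *: p + q) = a *: lquot_act x p + lquot_act x q.
Proof.
elim/lquot_ind: p => u; elim/lquot_ind: q => v.
by rewrite -linearP !lquot_act_pi act_linearr linearP.
Qed.
Fact lquot_act_lie x y q : lquot_act (lie x y) q
  = lquot_act x (lquot_act y q) - lquot_act y (lquot_act x q).
Proof. by elim/lquot_ind: q => v; rewrite !lquot_act_pi act_lie linearB. Qed.

HB.instance Definition _ := Lmodule_isLieModule.Build k g (lquot N)
  lquot_act_linearl lquot_act_linearr lquot_act_lie.

End LieQuotient.

Section GeneratedSubmodule.
Variables (k : comPzRingType) (g : lieType k) (V : lieModType g) (v0 : V).

Definition gensubmod : {pred V} := fun v => `[< forall N : {pred V},
  submod_closed N -> (forall (x : g) u, u \in N -> act x u \in N) ->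
  v0 \in N -> v \in N >].

Fact gensubmod_submod_closed : submod_closed gensubmod.
Proof.
split=> [|a u v /asboolP Nu /asboolP Nv]; apply/asboolP => N N2 Na Nv0.
  by case: N2.
by apply: N2.2; [apply: Nu|apply: Nv].
Qed.
Fact gensubmod_act_closed (x : g) v :
  v \in gensubmod -> act x v \in gensubmod.
Proof.
by move=> /asboolP Nv; apply/asboolP => N N2 Na Nv0; apply: (Na); exact: Nv.
Qed.
HB.instance Definition _ :=
  GRing.isSubmodClosed.Build k V gensubmod gensubmod_submod_closed.
HB.instance Definition _ :=
  isActClosed.Build k g V gensubmod gensubmod_act_closed.

End GeneratedSubmodule.

(* The free associative algebra on a set X, with the words as a basis. *)
Definition freealg (k : comPzRingType) (X : choiceType) : Type :=
  freemod k (seq X).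

Section FreeAlgebra.
Variables (k : comPzRingType) (X : choiceType).
Local Notation A := (freealg k X).

HB.instance Definition _ := GRing.Lmodule.copy A (freemod k (seq X)).

Definition fword (s : seq X) : A := fgen k s.
Definition fa_mul (p q : A) : A :=
  fext (fun s => fext (fun t => fword (s ++ t)) q) p.

Lemma fa_ind (P : A -> Prop) :
  P 0 -> (forall a s p, P p -> P (a *: fword s + p)) -> forall p, P p.
Proof. exact: freemod_ind. Qed.

Lemma fa_mulPl a (p q r : A) :
  fa_mul (a *: p + q) r = a *: fa_mul p r + fa_mul q r.
Proof. exact: linearP. Qed.
Lemma fa_mul0l (r : A) : fa_mul 0 r = 0. Proof. exact: linear0. Qed.

Lemma fa_mulw s (q : A) : fa_mul (fword s) q = fext (fun t => fword (s ++ t)) q.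
Proof. exact: fext_gen. Qed.

Lemma fa_mulPr a (p q r : A) :
  fa_mul p (a *: q + r) = a *: fa_mul p q + fa_mul p r.
Proof.
elim/fa_ind: p => [|b s p IHp]; first by rewrite !fa_mul0l scaler0 addr0.
rewrite !fa_mulPl IHp !fa_mulw [X in b *: X]linearP /=.
by rewrite !scalerDr !scalerA mulrC addrACA.
Qed.
Lemma fa_mul0r (r : A) : fa_mul r 0 = 0.
Proof. by move: (fa_mulPr (-1) r 0 0); rewrite scaler0 addr0 scaleN1r addNr. Qed.

Lemma fa_mulww s t : fa_mul (fword s) (fword t) = fword (s ++ t).
Proof. by rewrite fa_mulw fext_gen. Qed.

Lemma fa_mulwwA s t (r : A) :
  fa_mul (fword s) (fa_mul (fword t) r) = fa_mul (fword (s ++ t)) r.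
Proof.
elim/fa_ind: r => [|c u r IHr]; first by rewrite !fa_mul0r.
by rewrite !fa_mulPr IHr !fa_mulww catA.
Qed.

Lemma fa_mulwA s (q r : A) :
  fa_mul (fword s) (fa_mul q r) = fa_mul (fa_mul (fword s) q) r.
Proof.
elim/fa_ind: q => [|c u q IHq]; first by rewrite !(fa_mul0l, fa_mul0r).
by rewrite !(fa_mulPl, fa_mulPr) IHq fa_mulwwA fa_mulww.
Qed.

Fact fa_mulA : associative fa_mul.
Proof.
elim/fa_ind=> [|a s p IHp] q r; first by rewrite !fa_mul0l.
by rewrite !fa_mulPl IHp fa_mulwA.
Qed.
Fact fa_mul1 : left_id (fword [::]) fa_mul.
Proof.
by elim/fa_ind=> [|a s p IHp]; rewrite ?fa_mul0r // fa_mulPr IHp fa_mulww.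
Qed.
Fact fa_mulr1 : right_id (fword [::]) fa_mul.
Proof.
elim/fa_ind=> [|a s p IHp]; rewrite ?fa_mul0l //.
by rewrite fa_mulPl IHp fa_mulww cats0.
Qed.
Fact fa_mulDl : left_distributive fa_mul +%R.
Proof. by move=> p q r; rewrite -[p]scale1r fa_mulPl !scale1r. Qed.
Fact fa_mulDr : right_distributive fa_mul +%R.
Proof. by move=> p q r; rewrite -[q]scale1r fa_mulPr !scale1r. Qed.
HB.instance Definition _ := GRing.Zmodule_isPzRing.Build A
  fa_mulA fa_mul1 fa_mulr1 fa_mulDl fa_mulDr.

Lemma fa_scalerAl a (p q : A) : a *: (p * q) = (a *: p) * q.
Proof. by rewrite -[a *: p]addr0 [RHS]fa_mulPl fa_mul0l addr0. Qed.
Lemma fa_scalerAr a (p q : A) : a *: (p * q) = p * (a *: q).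
Proof. by rewrite -[a *: q]addr0 [RHS]fa_mulPr fa_mul0r addr0. Qed.

Definition fa_ideal (S : A -> Prop) : {pred A} := fun p =>
  `[< forall N : {pred A}, submod_closed N ->
      (forall u v w, v \in N -> u * v * w \in N) ->
      (forall v, S v -> v \in N) -> p \in N >].

Variable S : A -> Prop.

Fact fa_ideal_submod_closed : submod_closed (fa_ideal S).
Proof.
split=> [|a u v /asboolP Nu /asboolP Nv]; apply/asboolP => N N2 Na SN.
  by case: N2.
by apply: N2.2; [apply: Nu|apply: Nv].
Qed.
HB.instance Definition _ :=
  GRing.isSubmodClosed.Build k A (fa_ideal S) fa_ideal_submod_closed.

Lemma fa_idealM u v w : v \in fa_ideal S -> u * v * w \in fa_ideal S.
Proof.
by move=> /asboolP Nv; apply/asboolP => N N2 Na SN; apply: (Na); exact: Nv.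
Qed.

Lemma mem_fa_ideal v : S v -> v \in fa_ideal S.
Proof. by move=> Sv; apply/asboolP => N _ _; apply. Qed.

End FreeAlgebra.

Section EnvelopingAlgebra.
Variables (k : comPzRingType) (g : lieType k).
Local Notation T := (freealg k g).
Local Notation "[' x ]" := (fword k [:: x]).

(* The first family of relations turns the free algebra on the set g into the *)
(* tensor algebra of the k-module g.                                          *)
Inductive env_rel : T -> Prop :=
| EnvLinear (a : k) (x y : g) :
    env_rel (['a *: x + y] - (a *: ['x] + ['y]))
| EnvLie (x y : g) : env_rel (['x] * ['y] - ['y] * ['x] - ['lie x y]).

Definition envalg : Type := lquot (fa_ideal env_rel).
HB.instance Definition _ := GRing.Lmodule.copy envalg (lquot (fa_ideal env_rel)).

Definition epi (p : T) : envalg := lpi (fa_ideal env_rel) p.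

Lemma epi_is_linear : linear epi. Proof. exact: lpi_is_linear. Qed.
HB.instance Definition _ :=
  GRing.isLinear.Build k T envalg *:%R epi epi_is_linear.

Lemma envalg_ind (P : envalg -> Prop) : (forall p, P (epi p)) -> forall u, P u.
Proof. exact: lquot_ind. Qed.

Definition env_mul (u v : envalg) : envalg := epi (lrepr u * lrepr v).
Definition env_one : envalg := epi 1.

Lemma env_mul_pi p q : env_mul (epi p) (epi q) = epi (p * q).
Proof.
have repN (r : T) : lrepr (epi r) - r \in fa_ideal env_rel.
  by apply/lpiP; rewrite lreprK.
apply/lpiP; set p' := lrepr _; set q' := lrepr _.
have -> : p' * q' - p * q = 1 * (p' - p) * q' + p * (q' - q) * 1.
  by rewrite mul1r mulr1 mulrBl mulrBr addrA subrK.
by rewrite rpredD ?fa_idealM ?repN.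
Qed.

Fact env_mulA : associative env_mul.
Proof.
elim/envalg_ind=> p; elim/envalg_ind=> q; elim/envalg_ind=> r.
by rewrite !env_mul_pi mulrA.
Qed.
Fact env_mul1 : left_id env_one env_mul.
Proof. by elim/envalg_ind=> p; rewrite env_mul_pi mul1r. Qed.
Fact env_mulr1 : right_id env_one env_mul.
Proof. by elim/envalg_ind=> p; rewrite env_mul_pi mulr1. Qed.
Fact env_mulDl : left_distributive env_mul +%R.
Proof.
elim/envalg_ind=> p; elim/envalg_ind=> q; elim/envalg_ind=> r.
by rewrite -linearD !env_mul_pi -linearD mulrDl.
Qed.
Fact env_mulDr : right_distributive env_mul +%R.
Proof.
elim/envalg_ind=> p; elim/envalg_ind=> q; elim/envalg_ind=> r.
by rewrite -linearD !env_mul_pi -linearD mulrDr.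
Qed.
HB.instance Definition _ := GRing.Zmodule_isPzRing.Build envalg
  env_mulA env_mul1 env_mulr1 env_mulDl env_mulDr.

Lemma epiM p q : epi (p * q) = epi p * epi q.
Proof. by rewrite -env_mul_pi. Qed.
Lemma epiZ a p : epi (a *: p) = a *: epi p. Proof. exact: lpiZ_def. Qed.
Lemma env_scalerAl a (u v : envalg) : a *: (u * v) = (a *: u) * v.
Proof.
elim/envalg_ind: u => p; elim/envalg_ind: v => q.
by rewrite -epiM -!epiZ -epiM fa_scalerAl.
Qed.
Lemma env_scalerAr a (u v : envalg) : a *: (u * v) = u * (a *: v).
Proof.
elim/envalg_ind: u => p; elim/envalg_ind: v => q.
by rewrite -epiM -!epiZ -epiM fa_scalerAr.
Qed.

Definition eiota (x : g) : envalg := epi ['x].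

Fact eiota_is_linear : linear eiota.
Proof.
move=> a x y; have /mem_fa_ideal/lpiP e := EnvLinear a x y.
by rewrite /eiota [LHS]e; exact: (linearP epi).
Qed.
HB.instance Definition _ :=
  GRing.isLinear.Build k g envalg *:%R eiota eiota_is_linear.

Lemma eiota_lie x y : eiota (lie x y) = eiota x * eiota y - eiota y * eiota x.
Proof.
have /mem_fa_ideal/lpiP e := EnvLie x y.
by rewrite /eiota -!epiM -[LHS]e; exact: (linearB epi).
Qed.

End EnvelopingAlgebra.

Section InducedModule.
Variables (k : comPzRingType) (h g : lieType k) (f : h -> g) (W : lieModType h).
Local Notation U := (envalg g).
Local Notation F := (freemod k (U * W)%type).

Definition tgen (u : U) (w : W) : F := fgen k (u, w).

(* The relations defining U(g) (x)_{U(h)} W as a quotient of the free module  *)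
(* on U(g) x W, for h -> g the inclusion f of a subalgebra: since h generates *)
(* U(h), it is enough to balance the tensors over h.                          *)
Inductive ind_rel : F -> Prop :=
| IndLinearL (a : k) (u u' : U) (w : W) :
    ind_rel (tgen (a *: u + u') w - (a *: tgen u w + tgen u' w))
| IndLinearR (a : k) (u : U) (w w' : W) :
    ind_rel (tgen u (a *: w + w') - (a *: tgen u w + tgen u w'))
| IndBalanced (u : U) (x : h) (w : W) :
    ind_rel (tgen (u * eiota (f x)) w - tgen u (act x w)).

Definition indmod : Type := lquot (span ind_rel).
HB.instance Definition _ := GRing.Lmodule.copy indmod (lquot (span ind_rel)).

Definition ipi (p : F) : indmod := lpi (span ind_rel) p.
Lemma ipi_is_linear : linear ipi. Proof. exact: lpi_is_linear. Qed.
HB.instance Definition _ :=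
  GRing.isLinear.Build k F indmod *:%R ipi ipi_is_linear.

Definition itens (u : U) (w : W) : indmod := ipi (tgen u w).

Lemma itensPl a u u' w : itens (a *: u + u') w = a *: itens u w + itens u' w.
Proof.
have /mem_span/lpiP e := IndLinearL a u u' w.
by rewrite /itens [LHS]e; exact: (linearP ipi).
Qed.
Lemma itensBl u u' w : itens (u - u') w = itens u w - itens u' w.
Proof. by rewrite addrC -scaleN1r itensPl scaleN1r addrC. Qed.
Lemma itensPr a u w w' : itens u (a *: w + w') = a *: itens u w + itens u w'.
Proof.
have /mem_span/lpiP e := IndLinearR a u w w'.
by rewrite /itens [LHS]e; exact: (linearP ipi).
Qed.
Lemma itens_bal u x w : itens (u * eiota (f x)) w = itens u (act x w).
Proof. by have /mem_span/lpiP := IndBalanced u x w. Qed.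

Lemma indmod_ind (P : indmod -> Prop) : P 0 ->
  (forall a u w t, P t -> P (a *: itens u w + t)) -> forall t, P t.
Proof.
move=> P0 PD; elim/lquot_ind => p; elim/freemod_ind: p => [|a [u w] p IHp].
  by have -> : lpi (span ind_rel) 0 = 0 by exact: (linear0 ipi).
have -> : lpi (span ind_rel) (a *: tgen u w + p) = a *: itens u w + ipi p.
  exact: (linearP ipi).
exact: PD.
Qed.

Definition ind_act_free (x : g) : F -> indmod :=
  fext (fun p : U * W => itens (eiota x * p.1) p.2).
Definition ind_act (x : g) (t : indmod) : indmod := ind_act_free x (lrepr t).

Lemma ind_act_freeP x a p q :
  ind_act_free x (a *: p + q) = a *: ind_act_free x p + ind_act_free x q.
Proof. exact: (linearP (fext _)). Qed.

Lemma ind_act_freeB x p q :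
  ind_act_free x (p - q) = ind_act_free x p - ind_act_free x q.
Proof. exact: (linearB (fext _)). Qed.

Lemma ind_act_free_gen x u w :
  ind_act_free x (tgen u w) = itens (eiota x * u) w.
Proof. exact: fext_gen. Qed.

Lemma ind_act_free0 x p : p \in span ind_rel -> ind_act_free x p = 0.
Proof.
move: p; apply: span_ind.
- exact: (linear0 (fext _)).
- by move=> a u v u0 v0; rewrite ind_act_freeP u0 v0 scaler0 addr0.
move=> _ [a u u' w|a u w w'|u y w]; rewrite ind_act_freeB.
- by rewrite ind_act_freeP !ind_act_free_gen mulrDr -env_scalerAr itensPl subrr.
- by rewrite ind_act_freeP !ind_act_free_gen itensPr subrr.
- by rewrite !ind_act_free_gen mulrA itens_bal subrr.
Qed.

Lemma ind_act_pi x p : ind_act x (ipi p) = ind_act_free x p.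
Proof.
apply/eqP; rewrite -subr_eq0 -ind_act_freeB; apply/eqP.
by apply: ind_act_free0; apply/lpiP; rewrite lreprK.
Qed.

Lemma ind_act_tens x u w : ind_act x (itens u w) = itens (eiota x * u) w.
Proof. by rewrite ind_act_pi ind_act_free_gen. Qed.

Fact ind_act_linearr (a : k) x s t :
  ind_act x (a *: s + t) = a *: ind_act x s + ind_act x t.
Proof.
elim/lquot_ind: s => p; elim/lquot_ind: t => q.
rewrite -[lpi _ p]/(ipi p) -[lpi _ q]/(ipi q).
by rewrite -(linearP ipi) !ind_act_pi ind_act_freeP.
Qed.
Lemma ind_act0 x : ind_act x 0 = 0.
Proof.
by move: (ind_act_linearr (-1) x 0 0); rewrite scaler0 addr0 scaleN1r addNr.
Qed.

Fact ind_act_linearl (a : k) x y t :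
  ind_act (a *: x + y) t = a *: ind_act x t + ind_act y t.
Proof.
elim/indmod_ind: t => [|b u w t IHt]; first by rewrite !ind_act0 scaler0 addr0.
rewrite !ind_act_linearr IHt !ind_act_tens linearP mulrDl -env_scalerAl.
by rewrite itensPl !scalerDr !scalerA [b * a]mulrC addrACA.
Qed.
Fact ind_act_lie x y t :
  ind_act (lie x y) t = ind_act x (ind_act y t) - ind_act y (ind_act x t).
Proof.
elim/indmod_ind: t => [|b u w t IHt]; first by rewrite !ind_act0 subrr.
rewrite !ind_act_linearr IHt !ind_act_tens eiota_lie mulrBl !mulrA.
by rewrite itensBl opprD addrACA -scalerBr.
Qed.
HB.instance Definition _ := Lmodule_isLieModule.Build k g indmod
  ind_act_linearl ind_act_linearr ind_act_lie.

End InducedModule.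

(* m (m - 1) ... (m - n + 1) / n!; the division is exact. *)
Definition binz (m : int) (n : nat) : int :=
  ((\prod_(i < n) (m - i%:Z)) %/ (n`!)%:Z)%Z.

Lemma binz3 (m : int) : binz (m + 1) 3 * 6 = m ^+ 3 - m.
Proof.
rewrite /binz !big_ord_recl big_ord0 /= mulr1 !subr0.
have -> : (m + 1) * ((m + 1 - 1%:Z) * (m + 1 - 2%:Z)) = m ^+ 3 - m by ring.
apply/divzK; rewrite -[(3`!)%:Z]/(6 : int) [m](divz_eq m 6).
have := modz_ge0 m (isT : (6 : int) != 0).
have := ltz_pmod m (isT : 0 < (6 : int)).
move: (m %/ 6)%Z (modz _ _) => q [r|//] r6 _; apply/dvdzP.
exists (36 * q ^+ 3 + 18 * q ^+ 2 * r + 3 * q * r%:Z ^+ 2 - q + [:: 0; 0; 1; 4; 10; 20]`_r).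
by case: r r6 => [|[|[|[|[|[|//]]]]]] _; rewrite /=; ring.
Qed.

(* [Some n] indexes L(n) and [None] indexes K. *)
Definition vir (k : comPzRingType) : Type := freemod k (option int).

Section Virasoro.
Variable k : comPzRingType.
HB.instance Definition _ := GRing.Lmodule.copy (vir k) (freemod k (option int)).

Definition virL (n : int) : vir k := fgen k (Some n).
Definition virK : vir k := fgen k None.

Definition vir_br (i j : option int) : vir k :=
  match i, j with
  | Some m, Some n => (m - n)%:~R *: virL (m + n)
      + (if m + n == 0 then (binz (m + 1) 3)%:~R else 0) *: virK
  | _, _ => 0
  end.

End Virasoro.

HB.lock Definition vir_lie (k : comPzRingType) (x y : vir k) : vir k :=
  fext (fun i => fext (vir_br k i) y) x.

Section VirasoroLie.
Variable k : comPzRingType.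
Local Notation virL := (virL k).
Local Notation virK := (virK k).
Local Notation vir_br := (vir_br k).
Implicit Types x y z : vir k.

Lemma vir_lie_linearl a x y z :
  vir_lie (a *: x + y) z = a *: vir_lie x z + vir_lie y z.
Proof. by rewrite unlock; exact: (linearP (fext _)). Qed.

Lemma vir_lie0l z : vir_lie 0 z = 0.
Proof. by rewrite unlock; exact: (linear0 (fext _)). Qed.

Lemma vir_lie_gen i y : vir_lie (fgen k i) y = fext (vir_br i) y.
Proof. by rewrite unlock; exact: fext_gen. Qed.

Lemma vir_lie_gens i j : vir_lie (fgen k i) (fgen k j) = vir_br i j.
Proof. by rewrite vir_lie_gen fext_gen. Qed.

Lemma vir_lie_linearr a x y z :
  vir_lie x (a *: y + z) = a *: vir_lie x y + vir_lie x z.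
Proof.
elim/freemod_ind: x => [|b i x IHx]; first by rewrite !vir_lie0l scaler0 addr0.
rewrite !vir_lie_linearl IHx !vir_lie_gen linearP.
by rewrite !scalerDr !scalerA [b * a]mulrC addrACA.
Qed.

Lemma vir_lie0r x : vir_lie x 0 = 0.
Proof.
by move: (vir_lie_linearr (-1) x 0 0); rewrite scaler0 addr0 scaleN1r addNr.
Qed.

Lemma vir_brN i j : vir_br i j = - vir_br j i.
Proof.
case: i j => [m|] [n|]; rewrite /= ?oppr0 // [n + m]addrC opprD -!scaleNr.
congr (_ *: _ + _ *: _); first by rewrite -rmorphN opprB.
case: eqP => [mn0|]; last by rewrite oppr0.
rewrite -rmorphN; congr (_%:~R); have -> : n = - m by lia.
by have := binz3 m; have := binz3 (- m); rewrite exprNn /=; lia.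
Qed.

Lemma vir_lieN x y : vir_lie x y = - vir_lie y x.
Proof.
elim/freemod_ind: x => [|a i x IHx]; first by rewrite vir_lie0l vir_lie0r oppr0.
rewrite vir_lie_linearl vir_lie_linearr IHx opprD -scalerN.
congr (_ *: _ + _) => {IHx x}.
elim/freemod_ind: y => [|b j y IHy]; first by rewrite vir_lie0l vir_lie0r oppr0.
rewrite vir_lie_linearl vir_lie_linearr IHy opprD -scalerN.
by rewrite !vir_lie_gens vir_brN.
Qed.

Fact vir_liexx x : vir_lie x x = 0.
Proof.
elim/freemod_ind: x => [|a i x IHx]; first exact: vir_lie0l.
rewrite vir_lie_linearl !vir_lie_linearr IHx addr0 [vir_lie x _]vir_lieN.
rewrite scalerDr scalerN addrK vir_lie_gens.
suff -> : vir_br i i = 0 by rewrite !scaler0.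
case: i => //= m; rewrite subrr scale0r add0r.
case: eqP => [m0|]; last by rewrite scale0r.
have {m0} -> : m = 0 by lia.
by have b := binz3 0; rewrite (_ : binz _ 3 = 0) ?scale0r //; lia.
Qed.

Definition vir_jac (x y z : vir k) := vir_lie x (vir_lie y z)
  + vir_lie y (vir_lie z x) + vir_lie z (vir_lie x y).

Lemma addr3C (V : zmodType) (u v w : V) : u + v + w = v + w + u.
Proof. by rewrite -addrA addrC. Qed.

Lemma addr3ACA (V : zmodType) (u u' v v' w w' : V) :
  u + u' + (v + v') + (w + w') = u + v + w + (u' + v' + w').
Proof. by rewrite (addrACA u u') (addrACA _ _ w). Qed.

Lemma vir_jac_linear a x x' y z :
  vir_jac (a *: x + x') y z = a *: vir_jac x y z + vir_jac x' y z.
Proof.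
rewrite /vir_jac !(vir_lie_linearl, vir_lie_linearr) !scalerDr.
exact: addr3ACA.
Qed.

Lemma vir_jacC x y z : vir_jac x y z = vir_jac y z x.
Proof. exact: addr3C. Qed.

Lemma vir_lie_K x : vir_lie x virK = 0.
Proof.
rewrite /virK; elim/freemod_ind: x => [|a i x IHx]; first exact: vir_lie0l.
by rewrite vir_lie_linearl IHx vir_lie_gens; case: i => *; rewrite scaler0 addr0.
Qed.

Lemma vir_lie_LLL (l m n : int) :
  vir_lie (virL l) (vir_lie (virL m) (virL n))
  = ((m - n) * (l - (m + n)))%:~R *: virL (l + m + n)
    + (if l + m + n == 0 then (m - n) * binz (l + 1) 3 else 0)%:~R *: virK.
Proof.
rewrite [vir_lie (virL m) _]vir_lie_gens vir_lie_linearr.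
rewrite -[_ *: virK]addr0 vir_lie_linearr vir_lie_K vir_lie0r scaler0 !addr0.
rewrite vir_lie_gens scalerDr !scalerA -rmorphM !addrA; congr (_ + _ *: _).
by case: eqP; rewrite ?mulr0 // -rmorphM.
Qed.

Lemma vir_jac_gens i j l : vir_jac (fgen k i) (fgen k j) (fgen k l) = 0.
Proof.
wlog [[m [n [p [-> -> ->]]]]|->] : i j l / (exists m n p : int,
    [/\ i = Some m, j = Some n & l = Some p]) \/ l = None.
  move=> IH; case: i j l => [m|] [n|] [p|]; try by apply: IH; right.
  - by apply: IH; left; exists m, n, p.
  - by rewrite vir_jacC vir_jacC; apply: IH; right.
  - by rewrite vir_jacC; apply: IH; right.
  - by rewrite vir_jacC; apply: IH; right.
  rewrite /vir_jac !vir_lie_LLL.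
  have -> : n + p + m = m + n + p by lia.
  have -> : p + m + n = m + n + p by lia.
  rewrite addr3ACA -!scalerDl -!rmorphD /=.
  rewrite (_ : _ + _ = 0); last by lia.
  rewrite scale0r add0r; case: eqP => [mnp0|]; last by rewrite scale0r.
  rewrite (_ : _ + _ = 0) ?scale0r //.
  have -> : p = - (m + n) by lia.
  have := binz3 m; have := binz3 n; have := binz3 (- (m + n)) => h1 h2 h3.
  apply: (@mulIf _ (6 : int)) => //; rewrite mul0r !mulrDl -!mulrA h1 h2 h3.
  by ring.
have vir_lieKl x : vir_lie virK x = 0 by rewrite vir_lieN vir_lie_K oppr0.
by rewrite /vir_jac !vir_lieKl vir_lie_K !vir_lie0r !addr0.
Qed.

Lemma vir_jac_ext y z :
  (forall i, vir_jac (fgen k i) y z = 0) -> forall x, vir_jac x y z = 0.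
Proof.
move=> jac_gen; elim/freemod_ind=> [|a i x IHx].
  by rewrite /vir_jac !(vir_lie0l, vir_lie0r) !addr0.
by rewrite vir_jac_linear IHx jac_gen scaler0 addr0.
Qed.

Fact vir_jacobi x y z : vir_jac x y z = 0.
Proof.
apply: vir_jac_ext => i; rewrite vir_jacC.
apply: vir_jac_ext => j; rewrite vir_jacC.
by apply: vir_jac_ext => l; apply: vir_jac_gens.
Qed.

HB.instance Definition _ := Lmodule_isLie.Build k (vir k)
  vir_lie_linearl vir_lie_linearr vir_liexx vir_jacobi.

End VirasoroLie.

Section VirasoroGe.
Variable k : comPzRingType.

Definition virge_gen (x : vir k) : Prop :=
  x = virK k \/ exists m : nat, x = virL k m%:Z.
Definition virge_pred : {pred vir k} := span virge_gen.

Fact virge_submod_closed : submod_closed virge_pred.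
Proof. exact: span_submod_closed. Qed.
HB.instance Definition _ :=
  GRing.isSubmodClosed.Build k (vir k) virge_pred virge_submod_closed.

Definition vircoefK (x : vir k) : k := fcoef None x.

Lemma vircoefKP a x y :
  vircoefK (a *: x + y) = a * vircoefK x + vircoefK y.
Proof. exact: fcoefP. Qed.

Lemma virge_gen_lie x y : virge_gen x -> virge_gen y ->
  vir_lie x y \in virge_pred /\ vircoefK (vir_lie x y) = 0.
Proof.
have P0 : (0 : vir k) \in virge_pred /\ vircoefK 0 = 0.
  by split; [exact: rpred0|exact: fcoef0].
move=> [->|[m ->]] [->|[n ->]]; rewrite ?vir_lie_K //.
  by rewrite vir_lieN vir_lie_K oppr0.
rewrite vir_lie_gens /vir_br (_ : (if _ then _ else _) = 0); last first.
  case: eqP => // mn0; have -> : m%:Z = 0 by lia.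
  by have b := binz3 0; rewrite (_ : binz _ 3 = 0) //; lia.
rewrite scale0r addr0; split.
  by apply: rpredZ; apply: mem_span; right; exists (m + n)%N; rewrite PoszD.
rewrite -[X in vircoefK X]addr0 vircoefKP [vircoefK (virL _ _)]fcoef_gen mulr0.
by rewrite add0r; exact: P0.2.
Qed.

Lemma virge_lie_closed x y : x \in virge_pred -> y \in virge_pred ->
  vir_lie x y \in virge_pred /\ vircoefK (vir_lie x y) = 0.
Proof.
have P0 : (0 : vir k) \in virge_pred /\ vircoefK 0 = 0.
  by split; [exact: rpred0|exact: fcoef0].
have PD a u v : u \in virge_pred /\ vircoefK u = 0 ->
    v \in virge_pred /\ vircoefK v = 0 ->
    a *: u + v \in virge_pred /\ vircoefK (a *: u + v) = 0.
  move=> [Pu u0] [Pv v0]; split; first by rewrite rpredD ?rpredZ.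
  by rewrite vircoefKP u0 v0 mulr0 addr0.
move=> Px Py; move: x Px; apply: span_ind => [|a u v IHu IHv|x gx].
- by rewrite vir_lie0l.
- by rewrite vir_lie_linearl; apply: PD.
move: y Py; apply: span_ind => [|a u v IHu IHv|y gy].
- by rewrite vir_lie0r.
- by rewrite vir_lie_linearr; apply: PD.
exact: virge_gen_lie.
Qed.

Record virge : Type := VirGe {virge_val :> vir k; _ : virge_val \in virge_pred}.

HB.instance Definition _ := [isSub for virge_val].
HB.instance Definition _ := [Choice of virge by <:].
HB.instance Definition _ := [SubChoice_isSubZmodule of virge by <:].
HB.instance Definition _ := [SubZmodule_isSubLmodule of virge by <:].

Definition virge_lie (x y : virge) : virge :=
  VirGe (virge_lie_closed (valP x) (valP y)).1.

Fact virge_lie_linearl a x y z :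
  virge_lie (a *: x + y) z = a *: virge_lie x z + virge_lie y z.
Proof. by apply: val_inj; exact: vir_lie_linearl. Qed.
Fact virge_lie_linearr a x y z :
  virge_lie x (a *: y + z) = a *: virge_lie x y + virge_lie x z.
Proof. by apply: val_inj; exact: vir_lie_linearr. Qed.
Fact virge_liexx x : virge_lie x x = 0.
Proof. by apply: val_inj; exact: vir_liexx. Qed.
Fact virge_jacobi x y z : virge_lie x (virge_lie y z)
  + virge_lie y (virge_lie z x) + virge_lie z (virge_lie x y) = 0.
Proof. by apply: val_inj; exact: vir_jacobi. Qed.
HB.instance Definition _ := Lmodule_isLie.Build k virge
  virge_lie_linearl virge_lie_linearr virge_liexx virge_jacobi.

End VirasoroGe.

(* The free rank one module k v0, with v0 = 1. *)
Definition vac (k : comPzRingType) (c : k) : Type := k^o.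

Section Verma.
Variables (k : comPzRingType) (c : k).

HB.instance Definition _ := GRing.Lmodule.copy (vac c) k^o.

(* L(m) acts by 0 and K by c, so x acts through its coefficient on K alone. *)
Definition vac_act (x : virge k) (w : vac c) : vac c := (c * vircoefK x) *: w.

Fact vac_act_linearl a x y w :
  vac_act (a *: x + y) w = a *: vac_act x w + vac_act y w.
Proof.
rewrite /vac_act (_ : vircoefK _ = a * vircoefK x + vircoefK y); last first.
  by rewrite -vircoefKP.
by rewrite scalerA -scalerDl; congr (_ *: _); ring.
Qed.
Fact vac_act_linearr a x w w' :
  vac_act x (a *: w + w') = a *: vac_act x w + vac_act x w'.
Proof. by rewrite /vac_act scalerDr !scalerA mulrC. Qed.
Fact vac_act_lie x y w :
  vac_act (lie x y) w = vac_act x (vac_act y w) - vac_act y (vac_act x w).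
Proof.
rewrite /vac_act !scalerA [X in _ - X *: _]mulrC subrr.
rewrite (_ : vircoefK _ = 0) ?mulr0 ?scale0r //.
exact: (virge_lie_closed (valP x) (valP y)).2.
Qed.
HB.instance Definition _ := Lmodule_isLieModule.Build k (virge k) (vac c)
  vac_act_linearl vac_act_linearr vac_act_lie.

Definition verma : Type := indmod (@virge_val k) (vac c).
HB.instance Definition _ := LieModule.copy verma (indmod (@virge_val k) (vac c)).

Definition verma_v0 : verma :=
  itens (@virge_val k) (1 : envalg (vir k)) (1 : vac c).

Definition verma_I : {pred verma} := gensubmod (act (virL k (-1)) verma_v0).
HB.instance Definition _ := LieSubmodule.on verma_I.

Definition virM : Type := lquot verma_I.
HB.instance Definition _ := LieModule.copy virM (lquot verma_I).

Definition opL (n : int) (v : virM) : virM := act (virL k n) v.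

Definition u' (s : seq nat) : virM :=
  lpi verma_I (foldr (fun n v => act (virL k (- n%:Z)) v) verma_v0 s).

Definition u'_index (s : seq nat) : bool := sorted geq s && all (leq 2) s.

End Verma.

Arguments verma_I {k} c.
Arguments u' {k} c s.

(* Main.v *)
(* For n >= 2, [L(-1), L(-n-i)] = (n-1+i) L(-n-i-1) has no central term, since
   the degree -n-i-1 is nonzero, so the Leibniz rule gives
     L(-1)^m L(-n) = sum_i 'C(m, i) (n-1) n ... (n+i-2) L(-n-i) L(-1)^(m-i),
   where (n-1) n ... (n+i-2) = (-1)^i i! binz (1-n) i. This is m! times the
   recursion for D_m, so the identity holds on each u'(s) by induction on s.
   The u'(s) span: words in the L(-a), a >= 2, do, and modulo shorter words
   L(-a) and L(-b) commute. *)
From HB Require Import structures.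
Require Import Defs.
From mathcomp Require Import all_boot all_order all_algebra.
From mathcomp Require Import boolp ring zify.

Set Implicit Arguments.
Unset Strict Implicit.
Unset Printing Implicit Defensive.

Import GRing.Theory.
Local Open Scope ring_scope.

(** * Binomial coefficients and an abstract Leibniz rule *)

Lemma prod_rising_bin (b i : nat) :
  (\prod_(j < i) (b.+1 + j) = 'C(b + i, i) * i`!)%N.
Proof.
apply/eqP; rewrite -(eqn_pmul2r (fact_gt0 b)) -mulnA; apply/eqP.
have -> : ('C(b + i, i) * (i`! * b`!) = (b + i)`!)%N.
  by rewrite -{2}[b](addnK i) bin_fact // leq_addl.
elim: i => [|i IHi]; first by rewrite big_ord0 mul1n addn0.
by rewrite big_ord_recr /= mulnAC IHi addnS factS mulnC addSn.
Qed.

(** Each factor [- n + 1 - j] is the opposite of [n - 1 + j], and the rising product equals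
    ['C(n - 2 + i, i) * i!]. The division in [binz] is therefore exact, and the two signs cancel. *)
Lemma binz_neg_fact (n i : nat) : (2 <= n)%N ->
  (-1) ^+ i * binz (- n%:Z + 1) i * (i`!)%:Z = \prod_(j < i) (n%:Z - 1 + j%:Z).
Proof.
move=> n2.
have prodN : \prod_(j < i) (- n%:Z + 1 - j%:Z)
    = (-1) ^+ i * \prod_(j < i) (n%:Z - 1 + j%:Z).
  elim: i => [|i IHi]; first by rewrite !big_ord0 mulr1.
  by rewrite !big_ord_recr /= IHi exprS; ring.
have prod_bin : \prod_(j < i) (n%:Z - 1 + j%:Z)
    = ('C(n - 2 + i, i))%:Z * (i`!)%:Z.
  rewrite -PoszM -prod_rising_bin (big_morph Posz PoszM (erefl 1%:Z)).
  by apply: eq_bigr => j _; lia.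
rewrite /binz prodN prod_bin mulrA mulzK; last by have := fact_gt0 i; lia.
by rewrite [_ * (_ * _)]mulrA -exprMn mulrNN mulr1 expr1n mul1r.
Qed.

(** Induction on [m], with [d] general because moving one [X] past [Y d] also produces [Y d.+1]. *)
Lemma iter_leibniz (k : comPzRingType) (V : lmodType k)
    (X : {linear V -> V}) (Y : nat -> V -> V) (a : nat -> k) :
  (forall i v, X (Y i v) = Y i (X v) + a i *: Y i.+1 v) ->
  forall m d v, iter m X (Y d v) =
    \sum_(i < m.+1) ('C(m, i)%:R * \prod_(j < i) a (d + j)%N)
      *: Y (d + i)%N (iter (m - i) X v).
Proof.
move=> XY; elim=> [|m IHm] d v.
  by rewrite big_ord_recl !big_ord0 /= addn0 bin0 mulr1 scale1r addr0.
have iterD u w b : iter m X (u + b *: w) = iter m X u + b *: iter m X w.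
  by elim: (m) => //= p ->; rewrite linearD linearZ.
rewrite iterSr XY iterD !IHm big_ord_recl [RHS]big_ord_recl.
rewrite !big_ord0 !bin0 !subn0 !mulr1 !scale1r addn0 -iterSr -addrA.
congr (_ + _).
(* Pascal's rule: the ['C(m, i.+1)] half completes the sum for [Y d], its last term being zero, and
   the ['C(m, i)] half is the sum for [Y d.+1]. *)
under [RHS]eq_bigr => i _.
  rewrite /= /bump /= add1n binS natrD mulrDl scalerDl subSS; over.
rewrite big_split; congr (_ + _).
  rewrite [RHS]big_ord_recr /= bin_small // mulr0n mul0r scale0r addr0.
  apply: eq_bigr => i _; rewrite /bump /= add1n -iterSr.
  by congr (_ *: Y _ (iter _ X v)); have := ltn_ord i; lia.
rewrite scaler_sumr; apply: eq_bigr => i _.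
rewrite scalerA big_ord_recl /= addn0 addnS addSn mulrCA; congr (_ * (_ * _) *: _).
by apply: eq_bigr => j _; rewrite /bump /= add1n addnS.
Qed.

(** * Linearity and commutation for a Lie algebra action *)

Section LieModuleTheory.
Variables (k : comPzRingType) (g : lieType k) (V : lieModType g).
Implicit Types (x y : g) (v : V).

HB.instance Definition _ x := GRing.isLinear.Build k V V *:%R
  (act x) (fun a => act_linearr a x).

Lemma act0l v : act (0 : g) v = 0.
Proof.
by move: (act_linearl (-1) (0 : g) 0 v); rewrite scaler0 addr0 scaleN1r addNr.
Qed.

Lemma act_swap x y v : act x (act y v) = act y (act x v) + act (lie x y) v.
Proof. by rewrite act_lie addrC subrK. Qed.

Lemma act_span_closed (S : V -> Prop) x :
  (forall v, S v -> act x v \in Defs.span S) ->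
  forall v, v \in Defs.span S -> act x v \in Defs.span S.
Proof.
move=> Sx; apply: span_ind => [|a u v Nu Nv|//]; first by rewrite linear0 rpred0.
by rewrite linearP rpredD ?rpredZ.
Qed.

End LieModuleTheory.

(** * Operators on the quotient module and relations at the vacuum *)

Section Vacuum.
Variables (k : comPzRingType) (c : k).
Local Notation M := (virM c).
Local Notation v0 := (u' c [::]).
Implicit Types (v : M) (s : seq nat).

HB.instance Definition _ n := GRing.isLinear.Build k M M *:%R
  (@opL k c n) (fun a => act_linearr a (virL k n)).

Lemma opL_swap (m n : int) v : opL m (opL n v) = opL n (opL m v)
  + ((m - n)%:~R *: opL (m + n) v
     + (if m + n == 0 then (binz (m + 1) 3)%:~R else 0) *: act (virK k) v).
Proof.
rewrite /opL act_swap; congr (_ + _).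
rewrite -[lie _ _]/(vir_lie _ _) vir_lie_gens act_linearl; congr (_ + _).
by rewrite -[X in act X v]addr0 act_linearl act0l addr0.
Qed.

Lemma opL_swap_neg (m n : int) v : m + n < 0 ->
  opL m (opL n v) = opL n (opL m v) + (m - n)%:~R *: opL (m + n) v.
Proof. by move=> mn; rewrite opL_swap ifF ?scale0r ?addr0 //; lia. Qed.

Definition mpi (t : verma c) : M := lpi (verma_I c) t.

Lemma mpi_is_linear : linear mpi. Proof. exact: lpi_is_linear. Qed.
HB.instance Definition _ :=
  GRing.isLinear.Build k (verma c) M *:%R mpi mpi_is_linear.

Lemma mpi_act x (t : verma c) : mpi (act x t) = act x (mpi t).
Proof. exact: (esym (@lquot_act_pi k (vir k) (verma c) (verma_I c) x t)). Qed.

Definition vtens (u : envalg (vir k)) (w : vac c) : verma c :=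
  itens (@virge_val k) u w.

Lemma act_vtens x u w : act x (vtens u w) = vtens (eiota x * u) w.
Proof. exact: (ind_act_tens (@virge_val k)). Qed.

Lemma vtens_linearl a u u1 w :
  vtens (a *: u + u1) w = a *: vtens u w + vtens u1 w.
Proof. exact: itensPl. Qed.

Lemma vtens0l w : vtens 0 w = 0.
Proof.
by move: (vtens_linearl (-1) 0 0 w); rewrite scaler0 addr0 scaleN1r addNr.
Qed.

Lemma vtens_linearr a u w w1 :
  vtens u (a *: w + w1) = a *: vtens u w + vtens u w1.
Proof. exact: itensPr. Qed.

Lemma vtensZr u (a : k) w : vtens u (a *: w) = a *: vtens u w.
Proof.
have vtens0r : vtens u 0 = 0.
  by move: (vtens_linearr (-1) u 0 0); rewrite scaler0 addr0 scaleN1r addNr.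
by rewrite -[a *: w]addr0 vtens_linearr vtens0r addr0.
Qed.

Lemma u'_nil : v0 = mpi (vtens 1 (1 : k^o)).
Proof. by []. Qed.

Lemma u'_cons n s : u' c (n :: s) = opL (- n%:Z) (u' c s).
Proof. by rewrite /opL -[u' c s]/(mpi _) -mpi_act. Qed.

(** Balancing slides [x] across the tensor sign onto the generator of [vac c]. *)
Lemma virge_v0 (x : virge k) : act (virge_val x) v0 = (c * vircoefK x) *: v0.
Proof.
rewrite u'_nil -mpi_act act_vtens mulr1 -[eiota _]mul1r.
by rewrite [vtens _ _](itens_bal (@virge_val k)) -linearZ -vtensZr.
Qed.

Lemma opL_v0_ge (m : nat) : opL m%:Z v0 = 0.
Proof.
have Lm : virL k m%:Z \in @virge_pred k by apply: mem_span; right; exists m.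
rewrite /opL -[virL k _]/(virge_val (VirGe Lm)) virge_v0.
by rewrite /vircoefK fcoef_gen mulr0 scale0r.
Qed.

Lemma opLN1_v0 : opL (-1) v0 = 0.
Proof.
rewrite /opL -[v0]/(mpi (verma_v0 c)) -mpi_act -[RHS](linear0 mpi).
by apply/lpiP; rewrite subr0; apply/asboolP.
Qed.

(** [K] is central, so it passes every letter and reaches the vacuum, where it acts by [c]. *)
Lemma virK_u' s : act (virK k) (u' c s) = c *: u' c s.
Proof.
elim: s => [|n s IHs].
  have KP : virK k \in @virge_pred k by apply: mem_span; left.
  rewrite -[virK k]/(virge_val (VirGe KP)) virge_v0.
  by rewrite /vircoefK fcoef_gen eqxx mulr1.
rewrite u'_cons {1}/opL act_swap IHs -[lie _ _]/(vir_lie _ _) vir_lieN.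
by rewrite vir_lie_K oppr0 act0l addr0 linearZ.
Qed.

(** * Spanning by unsorted words *)

(** The vacuum generates: a tensor [u] with [w] is [w] times [u] with 1, and [u] is a combination of
    words, which act letter by letter. *)
Lemma virM_ind (P : M -> Prop) : P 0 ->
  (forall a u v, P u -> P v -> P (a *: u + v)) -> P v0 ->
  (forall x v, P v -> P (act x v)) -> forall v, P v.
Proof.
move=> P0 PD Pv0 Pact.
have PZ a v : P v -> P (a *: v) by move=> Pv; rewrite -[_ *: _]addr0; apply: PD.
have Pword (s : seq (vir k)) : P (mpi (vtens (epi (fword k s)) (1 : k^o))).
  elim: s => [//|x s IHs].
  have -> : epi (fword k (x :: s)) = eiota x * epi (fword k s).
    by rewrite /eiota -epiM -[_ * _ in RHS]/(fa_mul _ _) fa_mulww.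
  by rewrite -act_vtens mpi_act; apply: Pact.
have Pvtens u : P (mpi (vtens u (1 : k^o))).
  elim/envalg_ind: u => p; elim/fa_ind: p => [|a s p IHp].
    by rewrite linear0 vtens0l linear0.
  by rewrite linearP vtens_linearl linearP; apply: PD => //; apply: Pword.
elim/lquot_ind; elim/indmod_ind => [|a u w t IHt].
  by rewrite -[lpi _ _]/(mpi 0) linear0.
rewrite -[lpi _ _]/(mpi (a *: vtens u w + t)) linearP; apply: PD => //.
rewrite (_ : w = (w : k) *: (1 : k^o)); last by rewrite /GRing.scale /= mulr1.
by rewrite vtensZr linearZ; apply: PZ.
Qed.

(** Words are left unsorted so that prefixing a letter stays in the span. *)
Definition wordspan : {pred M} :=
  Defs.span (fun v => exists2 s, all (leq 2) s & v = u' c s).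
HB.instance Definition _ := GRing.SubmodClosed.on wordspan.

(** Moving [L(n)] past the first letter leaves [L(n)], the commutator and the central term acting on
    the shorter tail. On the empty word, [L(n)] with [n >= -1] gives zero. *)
Lemma opL_word s n : all (leq 2) s -> opL n (u' c s) \in wordspan.
Proof.
have opL_neg m v : m < -1 -> v \in wordspan -> opL m v \in wordspan.
  move=> m1; apply: act_span_closed => _ [t t2 ->].
  apply: mem_span; exists (`|m|%N :: t); first by rewrite /= t2 andbT; lia.
  by rewrite u'_cons; congr opL; lia.
elim: s n => [|a s IHs] n as2.
  case: (boolP (n < -1)) => [n1|].
    by apply: opL_neg => //; apply: mem_span; exists [::].
  case: n => [n _|[_|n /negP[]//]]; first by rewrite opL_v0_ge rpred0.
  by rewrite opLN1_v0 rpred0.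
have /andP[a2 s2] := as2.
rewrite u'_cons opL_swap; apply: rpredD.
  by apply: opL_neg; [lia|exact: IHs].
apply: rpredD; apply: rpredZ; first exact: IHs.
by rewrite virK_u'; apply: rpredZ; apply: mem_span; exists s.
Qed.

Lemma wordspanT v : v \in wordspan.
Proof.
elim/virM_ind: v => [|a u v Nu Nv||x v Nv].
- exact: rpred0.
- by rewrite rpredD ?rpredZ.
- by apply: mem_span; exists [::].
move: x; elim/freemod_ind=> [|a i x Nx]; first by rewrite act0l rpred0.
rewrite act_linearl rpredD ?rpredZ //; move: v Nv {Nx}.
apply: act_span_closed => _ [s s2 ->]; case: i => [n|]; first exact: opL_word.
by rewrite [act _ _]virK_u'; apply: rpredZ; apply: mem_span; exists s.
Qed.

(** * Sorting words modulo shorter ones *)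

Definition basisspan : {pred M} :=
  Defs.span (fun v => exists2 s, u'_index s & v = u' c s).
HB.instance Definition _ := GRing.SubmodClosed.on basisspan.

Section Sorting.
Variable r : nat.
Hypothesis short_words :
  forall s, (size s < r)%N -> all (leq 2) s -> u' c s \in basisspan.

Local Notation "s ~~ t" := (u' c s - u' c t \in basisspan) (at level 70).

Let congr_trans s1 s2 s3 : s1 ~~ s2 -> s2 ~~ s3 -> s1 ~~ s3.
Proof. by move=> N12 N23; rewrite -(subrK (u' c s2) (u' c s1)) -addrA rpredD. Qed.

(** The commutator merges [a] and [b] into the single letter [a + b], so the difference is a
    multiple of a shorter word, covered by [short_words]. *)
Lemma u'_swap_word p a b q : (size (p ++ a :: b :: q) <= r)%N ->
  all (leq 2) (p ++ a :: b :: q) -> (p ++ a :: b :: q) ~~ (p ++ b :: a :: q).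
Proof.
move=> sz abq2.
suff -> : u' c (p ++ a :: b :: q) - u' c (p ++ b :: a :: q)
    = (b%:Z - a%:Z)%:~R *: u' c (p ++ (a + b)%N :: q).
  apply: rpredZ; apply: short_words; first by move: sz; rewrite !size_cat /=; lia.
  by move: abq2; rewrite !all_cat /= => /and4P[-> a2 b2 ->]; lia.
have ab0 : (2 <= a)%N by move: abq2; rewrite all_cat /= => /and4P[].
elim: p {sz abq2} => [|n p IHp] /=; last first.
  by rewrite !u'_cons -linearB IHp linearZ.
rewrite !u'_cons opL_swap_neg; last by lia.
rewrite addrC addKr; congr (_%:~R *: opL _ _); lia.
Qed.

Lemma u'_shift_word p a t q : (size (p ++ a :: t ++ q) <= r)%N ->
  all (leq 2) (p ++ a :: t ++ q) -> (p ++ a :: t ++ q) ~~ (p ++ t ++ a :: q).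
Proof.
elim: t p => [|b t IHt] p sz p2; first by rewrite subrr rpred0.
apply: (@congr_trans _ (p ++ b :: a :: t ++ q)); first exact: u'_swap_word.
have := IHt (rcons p b); rewrite !cat_rcons; apply.
  by move: sz; rewrite !size_cat /= !size_cat /=; lia.
by move: p2; rewrite !all_cat /= !all_cat => /and5P[-> -> -> -> ->].
Qed.

(** Swaps the tail of [s1] with [s2] behind its first letter, then shifts that letter across [s2];
    the prefix [p] absorbs it in the induction. *)
Lemma u'_swap_blocks p s1 s2 s3 : (size (p ++ s1 ++ s2 ++ s3) <= r)%N ->
  all (leq 2) (p ++ s1 ++ s2 ++ s3) ->
  (p ++ s1 ++ s2 ++ s3) ~~ (p ++ s2 ++ s1 ++ s3).
Proof.
elim: s1 p => [|a s1 IHs] p sz ps2; first by rewrite subrr rpred0.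
apply: (@congr_trans _ (p ++ a :: s2 ++ s1 ++ s3)).
  by have := IHs (rcons p a); rewrite !cat_rcons; apply.
apply: u'_shift_word.
  by move: sz; rewrite !size_cat /= !size_cat; lia.
by move: ps2; rewrite !all_cat /= !all_cat => /and4P[-> /andP[-> ->] -> ->].
Qed.

Lemma u'_word_sort s :
  (size s <= r)%N -> all (leq 2) s -> u' c s \in basisspan.
Proof.
(* [P] carries the size and letter bounds because [catCA_perm_ind], which transports it from the
   sorted word to [s], needs stability under block swaps. *)
pose P t := [/\ (size t <= r)%N, all (leq 2) t & u' c t \in basisspan].
suff Psort : P (sort geq s) -> P s.
  move=> sz s2; have [] // := Psort; split.
  - by rewrite size_sort.
  - by rewrite all_sort.
  apply: mem_span; exists (sort geq s) => //.
  by rewrite /u'_index all_sort s2 sort_sorted // => m n; apply: leq_total.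
apply: (catCA_perm_ind (P := P)); last by rewrite perm_sort.
move=> s1 s2 s3 [sz st2 Ns]; split.
- by move: sz; rewrite !size_cat; lia.
- by move: st2; rewrite !all_cat andbCA.
have := @u'_swap_blocks [::] s1 s2 s3 sz st2; rewrite -rpredN opprB => N12.
by rewrite -(subrK (u' c (s1 ++ s2 ++ s3)) (u' c _)) rpredD.
Qed.

End Sorting.

(** Strong induction on word length discharges [short_words]. *)
Lemma basisspanT v : v \in basisspan.
Proof.
move: v (wordspanT v); apply: span_ind => [|a u v Nu Nv|_ [s s2 ->]].
- exact: rpred0.
- by rewrite rpredD ?rpredZ.
have [r] := ubnP (size s); elim: r s s2 => // r IHr s s2 sz.
by apply: (@u'_word_sort r) => // t tr t2; apply: IHr.
Qed.

(** * Powers of [L(-1)] and the divided powers *)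

(** The case [d = 0] of [iter_leibniz] with [a i = n - 1 + i]; the total degree [-1 - n - i] is
    negative, which excludes a central term. *)
Lemma opLN1_leibniz (n m : nat) v : (2 <= n)%N ->
  iter m (opL (-1)) (opL (- n%:Z) v) = \sum_(i < m.+1)
    ('C(m, i)%:R * ((-1) ^+ i * binz (- n%:Z + 1) i * (i`!)%:Z)%:~R)
      *: opL (- n%:Z - i%:Z) (iter (m - i) (opL (-1)) v).
Proof.
pose Y i : M -> M := opL (- n%:Z - i%:Z).
move=> n2; have XY i w :
    opL (-1) (Y i w) = Y i (opL (-1) w) + (n%:Z - 1 + i%:Z)%:~R *: Y i.+1 w.
  rewrite /Y opL_swap_neg; last by lia.
  congr (_ + _%:~R *: opL _ _); lia.
have := iter_leibniz XY m 0 v; rewrite {1}/Y subr0 => ->.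
apply: eq_bigr => i _; congr (_ * _ *: _).
by rewrite binz_neg_fact // rmorph_prod.
Qed.

End Vacuum.

Theorem lemma7p5 (k : comPzRingType) (c : k)
  (D : nat -> {linear virM c -> virM c})
  (D0_v0 : D 0%N (u' c [::]) = u' c [::])
  (D_v0 : forall m : nat, (1 <= m)%N -> D m (u' c [::]) = 0)
  (D_u' : forall (m n : nat) (s : seq nat), u'_index (n :: s) ->
    D m (u' c (n :: s)) =
      \sum_(i < m.+1) ((-1) ^+ i * (binz (- n%:Z + 1) i)%:~R) *:
        opL (- n%:Z - i%:Z) (D (m - i)%N (u' c s))) :
  forall (m : nat) (v : virM c),
    iter m (opL (-1)) v = iter m (D 1%N) v /\
    iter m (D 1%N) v = (m`!)%:R *: D m v.
Proof.
have iterD_u' s m : u'_index s ->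
    iter m (opL (-1)) (u' c s) = (m`!)%:R *: D m (u' c s).
  elim: s m => [|n s IHs] m idx.
    case: m => [|m]; first by rewrite /= D0_v0 scale1r.
    (* For positive exponents both sides vanish on the vacuum. *)
    rewrite D_v0 // scaler0 iterSr opLN1_v0.
    by elim: m => //= m ->; rewrite linear0.
  have /andP[n2 _] : (2 <= n)%N && all (leq 2) s by have /andP[] := idx.
  have idx_s : u'_index s.
    have /andP[/= ns /andP[_ s2]] := idx.
    by rewrite /u'_index s2 (path_sorted ns).
  rewrite u'_cons opLN1_leibniz // -u'_cons D_u' // scaler_sumr.
  apply: eq_bigr => i _; rewrite IHs // linearZ !scalerA; congr (_ *: _).
  (* The factor [(m - i)!] from the induction hypothesis completes ['C(m, i) * i!] to [m!]. *)
  rewrite -(bin_fact (ltn_ord i : i <= m)%N) !natrM !rmorphM rmorphXn rmorphN1.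
  by rewrite /= -pmulrn; ring.
have iterD m v : iter m (opL (-1)) v = (m`!)%:R *: D m v.
  move: v (basisspanT v); apply: span_ind => [|a u v IHu IHv|_ [s idx ->]].
  - by rewrite linear0 scaler0; elim: m => //= m ->; rewrite linear0.
  - rewrite linearP scalerDr scalerA mulrC -scalerA -IHu -IHv.
    by elim: m {IHu IHv} => //= m ->; rewrite linearP.
  exact: iterD_u'.
move=> m v; suff iter_eq : iter m (opL (-1)) v = iter m (D 1%N) v.
  by rewrite -iter_eq.
(* Since [1! = 1], the case [m = 1] identifies [L(-1)] with [D 1] pointwise. *)
by apply: eq_iter => w; have := iterD 1%N w; rewrite scale1r.
Qed.
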